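(* The category $\mathcal Prm(S_d)$ is closed under tensor product $\otimes$ (of representations of $S_d$). In particular the bifunctor $\cdot\otimes\cdot:\mathcal Prm(S_d)\times\mathcal Prm(S_d)\to\mathcal Prm(S_d)$ can be expressed as follows. Let $\lambda,\mu\vdash d$ be of length $m$, $n$ respectively. On objects: $$M^\lambda\otimes M^\mu=\bigoplus_{A\in A^\lambda_\mu}M^A=\bigoplus_{A\in A^\mu_\lambda}M^A .$$ On morphisms: $$E_j1_\lambda\otimes1_\mu=\sum_{A\in A^\mu_\lambda}\sum_{i=1}^nE_{ij}1_A:\bigoplus_{A\in A^\mu_\lambda}M^A\to\bigoplus_{A\in A^\mu_{\lambda+\alpha_j}}M^A,$$ $$F_j1_\lambda\otimes1_\mu=\sum_{A\in A^\mu_\lambda}\sum_{i=1}^nF_{ij}1_A:\bigoplus_{A\in A^\mu_\lambda}M^A\to\bigoplus_{A\in A^\mu_{\lambda-\alpha_j}}M^A,$$ $$1_\lambda\otimes E_j1_\mu=\sum_{A\in A^\lambda_\mu}\sum_{i=1}^mE_{ij}1_A:\bigoplus_{A\in A^\lambda_\mu}M^A\to\bigoplus_{A\in A^\lambda_{\mu+\alpha_j}}M^A,$$ $$1_\lambda\otimes F_j1_\mu=\sum_{A\in A^\lambda_\mu}\sum_{i=1}^mF_{ij}1_A:\bigoplus_{A\in A^\lambda_\mu}M^A\to\bigoplus_{A\in A^\lambda_{\mu-\alpha_j}}M^A,$$ where $1\le j\le m-1$ in the first two formulas and $1\le j\le n-1$ in the last two.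
   Context: For a finite sequence $\lambda=(\lambda_1,\dots,\lambda_n)$ of nonnegative integers with sum $d$, a $\lambda$-tabloid is a dissection $T=\{T^1,\dots,T^n\}$ of $\{1,\dots,d\}$ with $|T^i|=\lambda_i$ ($T^i$ is the $i$-th cell). $M^\lambda$ is the $\mathbb C$-span of $\lambda$-tabloids, with right $S_d$-action $(Tg)^i=g^{-1}(T^i)$; it is the permutation module $\mathbb C[S_\lambda\backslash S_d]$, $S_\lambda$ the Young subgroup. $\mathcal Prm(S_d)$ is the full skeletal subcategory of $\mathcal Rep\,S_d$ whose objects are direct sums of the $M^\lambda$, $\lambda\vdash d$ a partition. For any nonnegative sequence $\lambda$ with sum $d$, $M^\lambda$ also denotes the object $M^\mu$, where $\mu$ is the partition obtained by deleting zeros of $\lambda$ and reordering. $\alpha_j=(0,\dots,0,1,-1,0,\dots,0)$ with $1$ in position $j$. For a nonnegative sequence $\lambda$, $E_i1_\lambda:M^\lambda\to M^{\lambda+\alpha_i}$ sends a tabloid $T$ to the sum, over all $k\in T^{i+1}$, of the tabloid obtained from $T$ by moving $k$ to cell $i$; $F_i1_\lambda:M^\lambda\to M^{\lambda-\alpha_i}$ sends $T$ to the sum, over all $k\in T^i$, of the tabloid obtained by moving $k$ to cell $i+1$ (so these are $0$ if the relevant cell is empty). For nonnegative sequences $\lambda$ of length $m$ and $\mu$ of length $n$ with sum $d$, $A^\lambda_\mu$ is the set of $m\times n$ matrices $A$ with entries in $\mathbb N=\{0,1,2,\dots\}$ with $\lambda_i=\sum_jA_{ij}$ and $\mu_j=\sum_iA_{ij}$.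 For such $A$, $M^A$ is the permutation module of the sequence $(A_{11},A_{12},\dots,A_{21},A_{22},\dots,A_{mn})$; its basis consists of $A$-tabloids, i.e. dissections $\{T^{ij}\}$ of $\{1,\dots,d\}$ with $|T^{ij}|=A_{ij}$. With $e_{ij}$ the matrix units, $E_{ij}1_A:M^A\to M^{A+e_{ij}-e_{i,j+1}}$ sends $T$ to the sum over $k\in T^{i,j+1}$ of the tabloid obtained by moving $k$ to cell $(i,j)$, and $F_{ij}1_A:M^A\to M^{A-e_{ij}+e_{i,j+1}}$ sends $T$ to the sum over $k\in T^{ij}$ of the tabloid obtained by moving $k$ to cell $(i,j+1)$. The equalities $M^\lambda\otimes M^\mu=\bigoplus_{A\in A^\lambda_\mu}M^A$ and $M^\lambda\otimes M^\mu=\bigoplus_{A\in A^\mu_\lambda}M^A$ are the identifications sending $T\otimes T'$ to the tabloid with $(i,j)$-cell $T^i\cap T'^j$, respectively $T^j\cap T'^i$. A sum of morphisms between summands denotes the morphism between direct sums with these as matrix components. *)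

(* Defs.v *)
From HB Require Import structures.
From mathcomp Require Import all_boot all_order all_algebra all_fingroup.
From mathcomp Require Import finmap multiset reals complex.

Set Implicit Arguments.
Unset Strict Implicit.
Unset Printing Implicit Defensive.

Import GRing.Theory VectorInternalTheory.
Local Open Scope ring_scope.

Section DirectSum.
Variables (C : fieldType) (I : finType) (V : I -> vectType C).

Definition dsum : Type := {dffun forall i, V i}.
HB.instance Definition _ := Choice.on dsum.
Implicit Types u v w : dsum.

Definition dsum0 : dsum := [ffun i => 0].
Definition dsum_opp u : dsum := [ffun i => - u i].
Definition dsum_add u v : dsum := [ffun i => u i + v i].
Definition dsum_scale (a : C) u : dsum := [ffun i => a *: u i].

Fact dsum_addA : associative dsum_add.
Proof. by move=> u v w; apply/ffunP=> i; rewrite !ffunE addrA. Qed.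
Fact dsum_addC : commutative dsum_add.
Proof. by move=> u v; apply/ffunP=> i; rewrite !ffunE addrC. Qed.
Fact dsum_add0 : left_id dsum0 dsum_add.
Proof. by move=> u; apply/ffunP=> i; rewrite !ffunE add0r. Qed.
Fact dsum_addN : left_inverse dsum0 dsum_opp dsum_add.
Proof. by move=> u; apply/ffunP=> i; rewrite !ffunE addNr. Qed.
HB.instance Definition _ :=
  GRing.isZmodule.Build dsum dsum_addA dsum_addC dsum_add0 dsum_addN.

Fact dsum_scaleA a b u :
  dsum_scale a (dsum_scale b u) = dsum_scale (a * b) u.
Proof. by apply/ffunP=> i; rewrite !ffunE scalerA. Qed.
Fact dsum_scale1 : left_id 1 dsum_scale.
Proof. by move=> u; apply/ffunP=> i; rewrite !ffunE scale1r. Qed.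
Fact dsum_scaleDr : right_distributive dsum_scale +%R.
Proof. by move=> a u v; apply/ffunP=> i; rewrite !ffunE scalerDr. Qed.
Fact dsum_scaleDl u : {morph dsum_scale^~ u : a b / a + b}.
Proof. by move=> a b; apply/ffunP=> i; rewrite !ffunE scalerDl. Qed.
HB.instance Definition _ := GRing.Zmodule_isLmodule.Build C dsum
  dsum_scaleA dsum_scale1 dsum_scaleDr dsum_scaleDl.

Fact dsum_vect_iso :
  Vector.axiom (\sum_(k < #|I|) dim (V (enum_val k)))%N dsum.
Proof.
pose fr (u : dsum) := \mxrow_(k < #|I|) v2r (u (enum_val k)).
exists fr.
  move=> a u v; apply/rowP=> c; rewrite !mxE !ffunE linearP.
  by rewrite !mxE.
pose gr (r : 'rV[C]_(\sum_(k < #|I|) dim (V (enum_val k)))) : dsum :=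
  [ffun i => ecast j (V j) (enum_rankK i) (r2v (submxrow r (enum_rank i)))].
have castE (u : dsum) i j (e : i = j) : ecast k (V k) e (u i) = u j.
  by case: j / e.
exists gr => [u|r].
  by apply/ffunP=> i; rewrite ffunE /fr mxrowK v2rK castE.
apply/mxrowP => k; rewrite /fr mxrowK ffunE.
suff H i (e : enum_val i = enum_val k) :
    i = k -> v2r (ecast j (V j) e (r2v (submxrow r i))) = submxrow r k.
  by apply: H; rewrite enum_valK.
by move=> eik; case: k / eik e => e; rewrite (eq_axiomK e) /= r2vK.
Qed.
HB.instance Definition _ := Lmodule_hasFinDim.Build C dsum dsum_vect_iso.

Definition dsum_in i (x : V i) : dsum :=
  [ffun j => if i =P j is ReflectT e then ecast k (V k) e x else 0].

Definition dproj i : 'Hom(dsum, V i) := linfun (fun u : dsum => u i).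
Definition dinj i : 'Hom(V i, dsum) := linfun (@dsum_in i).
End DirectSum.

(* [linfun] is only meaningful on linear functions; the lemmas ending in E
   compute the maps that are defined through it. *)
Lemma linfunE (C : fieldType) (V W : vectType C) (f : V -> W) :
  linear f -> linfun f =1 f.
Proof.
move=> lf.
pose fL : {linear V -> W} := HB.pack f (GRing.isLinear.Build C V W _ f lf).
exact: (lfunE fL).
Qed.

Section DirectSumTheory.
Variables (C : fieldType) (I : finType) (V : I -> vectType C).

Lemma dprojE i (u : dsum V) : dproj V i u = u i.
Proof. by apply: linfunE => a v w; rewrite !ffunE. Qed.

Lemma dinjE i (x : V i) : dinj V i x = dsum_in x.
Proof.
apply: linfunE => a y z; apply/ffunP=> j; rewrite !ffunE.
by case: eqP => [e|_]; [case: j / e | rewrite scaler0 addr0].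
Qed.

Lemma dinjK i x : dproj V i (dinj V i x) = x.
Proof.
by rewrite dprojE dinjE ffunE; case: eqP => // e; rewrite (eq_axiomK e).
Qed.

Lemma dinj_neq i j x : i != j -> dproj V j (dinj V i x) = 0.
Proof.
by rewrite dprojE dinjE ffunE => /eqP nij; case: eqP.
Qed.
End DirectSumTheory.

Section Tensor.
Variable C : fieldType.
Implicit Types V W U : vectType C.

(* V (x) W is modelled by the matrices of coordinates of its elements on the
   basis (e_i (x) e'_j), where e and e' are the chosen bases of V and W.
   [tlift] gives the universal property: see [tliftE] and [tens_ext]. *)
Definition tensor V W : vectType C := 'M[C]_(\dim {:V}, \dim {:W}).

Definition tens V W (v : V) (w : W) : tensor V W :=
  \matrix_(i, j) (coord (vbasis {:V}) i v * coord (vbasis {:W}) j w).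

Definition tlift V W U (b : V -> W -> U) : 'Hom(tensor V W, U) :=
  linfun (fun A : tensor V W =>
    \sum_i \sum_j A i j *: b (vbasis {:V})`_i (vbasis {:W})`_j).

Definition is_bilinear V W U (b : V -> W -> U) : Prop :=
  (forall w, linear (b^~ w)) /\ (forall v, linear (b v)).

Definition tmap V V' W W' (f : 'Hom(V, V')) (g : 'Hom(W, W')) :
    'Hom(tensor V W, tensor V' W') :=
  tlift (fun v w => tens (f v) (g w)).

Lemma linear_sumZ V U (f : V -> U) (lf : linear f) (K : finType)
    (a : K -> C) (x : K -> V) :
  f (\sum_k a k *: x k) = \sum_k a k *: f (x k).
Proof.
rewrite -(linfunE lf) linear_sum; apply: eq_bigr => k _.
by rewrite linearZ /= (linfunE lf).
Qed.

Lemma vbasis_expand V (v : V) :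
  v = \sum_i coord (vbasis {:V}) i v *: (vbasis {:V})`_i.
Proof. exact: (coord_vbasis (memvf v)). Qed.

Lemma tlift_linear V W U (b : V -> W -> U) A :
  tlift b A = \sum_i \sum_j A i j *: b (vbasis {:V})`_i (vbasis {:W})`_j.
Proof.
rewrite /tlift linfunE // => a u v.
rewrite scaler_sumr -big_split /=; apply: eq_bigr => i _.
rewrite scaler_sumr -big_split /=; apply: eq_bigr => j _.
by rewrite !mxE scalerDl scalerA.
Qed.

Lemma tliftE V W U (b : V -> W -> U) :
  is_bilinear b -> forall v w, tlift b (tens v w) = b v w.
Proof.
move=> [bl br] v w; rewrite tlift_linear.
rewrite [in RHS](vbasis_expand v) (linear_sumZ (bl w)).
apply: eq_bigr => i _; rewrite [in RHS](vbasis_expand w).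
rewrite (linear_sumZ (br _)) scaler_sumr; apply: eq_bigr => j _.
by rewrite mxE scalerA.
Qed.

Lemma tens_bilinear V W : is_bilinear (@tens V W).
Proof.
split=> [w a v v'|v a w w']; apply/matrixP=> i j; rewrite !mxE linearP /=.
  by rewrite mulrDl mulrA.
by rewrite mulrDr mulrCA.
Qed.

Lemma tens_ext V W U (f g : 'Hom(tensor V W, U)) :
  (forall v w, f (tens v w) = g (tens v w)) -> f = g.
Proof.
move=> fg; apply/lfunP => A.
have -> : A = \sum_i \sum_j A i j *: tens (vbasis {:V})`_i (vbasis {:W})`_j.
  apply/matrixP=> i j; rewrite summxE (bigD1 i) //= summxE (bigD1 j) //=.
  have cE T (k l : 'I_(\dim {:T})) : coord (vbasis {:T}) k (vbasis {:T})`_l = (k == l)%:R :> C.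
    by rewrite coord_free ?(basis_free (vbasisP _)) // eq_sym.
  rewrite !mxE !cE !eqxx !mulr1 big1 ?addr0 => [|l nl]; last first.
    by rewrite !mxE !cE eq_sym (negPf nl) mulr0 mulr0.
  rewrite big1 ?addr0 // => k nk; rewrite summxE big1 // => l _.
  by rewrite !mxE !cE eq_sym (negPf nk) mul0r mulr0.
rewrite !linear_sum; apply: eq_bigr => i _.
rewrite !linear_sum; apply: eq_bigr => j _.
by rewrite !linearZ /= fg.
Qed.

Lemma tmapE V V' W W' (f : 'Hom(V, V')) (g : 'Hom(W, W')) v w :
  tmap f g (tens v w) = tens (f v) (g w).
Proof.
have [tl tr] := @tens_bilinear V' W'.
apply: (tliftE (b := fun v w => tens (f v) (g w))).
by split=> [y a x x'|x a y y']; rewrite linearP ?tl ?tr.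
Qed.

Lemma tmap_id V W : tmap \1%VF \1%VF = \1%VF :> 'End(tensor V W).
Proof. by apply: tens_ext => v w; rewrite tmapE !id_lfunE. Qed.

Lemma tmap_comp V V' V'' W W' W'' (f : 'Hom(V, V')) (f' : 'Hom(V', V''))
    (g : 'Hom(W, W')) (g' : 'Hom(W', W'')) :
  tmap (f' \o f) (g' \o g) = (tmap f' g' \o tmap f g)%VF.
Proof. by apply: tens_ext => v w; rewrite comp_lfunE !tmapE !comp_lfunE. Qed.
End Tensor.

Section Representations.
Variables (C : fieldType) (d : nat).

(* Right modules over S_d, for the product (g h)(x) = g (h x) of permutations.
   The product of the library is the opposite one, (h * g)%g x = g (h x); so
   the right module law v (g h) = (v g) h reads as in [rep_actM]. *)
Record rep := Rep {
  rep_space :> vectType C;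
  rep_act : 'S_d -> 'End(rep_space);
  rep_act1 : rep_act 1%g = \1%VF;
  rep_actM : forall g h, rep_act (h * g)%g = (rep_act h \o rep_act g)%VF }.

Definition rep_hom (X Y : rep) (f : 'Hom(X, Y)) : Prop :=
  forall g, (f \o rep_act X g = rep_act Y g \o f)%VF.

Definition rep_isom (X Y : rep) (f : 'Hom(X, Y)) : Prop :=
  rep_hom f /\ bijective f.

Definition rep_iso (X Y : rep) : Prop := exists f : 'Hom(X, Y), rep_isom f.

Section TensorRep.
Variables X Y : rep.
Definition tensor_act (g : 'S_d) : 'End(tensor X Y) :=
  tmap (rep_act X g) (rep_act Y g).
Fact tensor_act1 : tensor_act 1%g = \1%VF.
Proof. by rewrite /tensor_act !rep_act1 tmap_id. Qed.
Fact tensor_actM g h :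
  tensor_act (h * g)%g = (tensor_act h \o tensor_act g)%VF.
Proof. by rewrite /tensor_act !rep_actM tmap_comp. Qed.
Definition tensor_rep : rep := Rep tensor_act1 tensor_actM.
End TensorRep.

Section DirectSumRep.
Variables (I : finType) (X : I -> rep).
Definition dsum_act (g : 'S_d) : 'End(dsum X) :=
  \sum_i (dinj X i \o rep_act (X i) g \o dproj X i)%VF.
Lemma dsum_actE g (u : dsum X) : dsum_act g u = [ffun i => rep_act (X i) g (u i)].
Proof.
apply/ffunP=> i; rewrite sum_lfunE -dprojE linear_sum (bigD1 i) //=.
rewrite big1 => [|j nji]; rewrite !comp_lfunE; last by rewrite dinj_neq.
by rewrite dinjK dprojE ffunE addr0.
Qed.
Fact dsum_act1 : dsum_act 1%g = \1%VF.
Proof.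
apply/lfunP=> u; rewrite dsum_actE id_lfunE; apply/ffunP=> i.
by rewrite ffunE rep_act1 id_lfunE.
Qed.
Fact dsum_actM g h : dsum_act (h * g)%g = (dsum_act h \o dsum_act g)%VF.
Proof.
apply/lfunP=> u; rewrite comp_lfunE !dsum_actE; apply/ffunP=> i.
by rewrite !ffunE rep_actM comp_lfunE.
Qed.
Definition dsum_rep : rep := Rep dsum_act1 dsum_actM.
End DirectSumRep.

Lemma tmap_hom (X X' Y Y' : rep) (f : 'Hom(X, X')) (g : 'Hom(Y, Y')) :
  rep_hom f -> rep_hom g ->
  rep_hom (X := tensor_rep X Y) (Y := tensor_rep X' Y') (tmap f g).
Proof. by move=> hf hg s; rewrite /= /tensor_act -!tmap_comp hf hg. Qed.
End Representations.

(* Shapes take values in the integers, so that lambda + alpha_j always makes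
   sense; there are no tabloids, and M^lambda = 0, if lambda has a negative
   entry.  The index type of the cells is 'I_m or 'I_m * 'I_n. *)
Notation tshape I := {ffun I -> int}.

Definition unit_shape (I : finType) (p : I) : tshape I :=
  [ffun q => (q == p)%:R].

Section Tabloids.
Variables (d : nat) (I : finType).
Implicit Types (a b : tshape I) (t : {ffun I -> {set 'I_d}}).

Definition is_tabloid a t : bool :=
  [&& [forall p, forall q, (p != q) ==> [disjoint t p & t q]],
      \bigcup_p t p == [set: 'I_d]
    & [forall p, (#|t p|)%:Z == a p]].

Definition tabloid a : Type := {t : {ffun I -> {set 'I_d}} | is_tabloid a t}.
HB.instance Definition _ a := SubFinite.on (tabloid a).

Definition tab_act (g : 'S_d) t : {ffun I -> {set 'I_d}} :=
  [ffun p => [set (g^-1)%g x | x in t p]].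

Definition tab_move (p : I) (k : 'I_d) t : {ffun I -> {set 'I_d}} :=
  [ffun q => if q == p then k |: t q else t q :\ k].

Lemma tab_act1 t : tab_act 1%g t = t.
Proof.
apply/ffunP=> p; rewrite ffunE invg1; apply/setP=> x.
by rewrite -{1}[x](perm1 x) mem_imset //; apply: perm_inj.
Qed.

Lemma in_tab_act g t p x : (x \in tab_act g t p) = (g x \in t p).
Proof.
by rewrite ffunE -{1}[x](permK g) mem_imset //; apply: perm_inj.
Qed.

Lemma tab_actM g h t : tab_act (h * g)%g t = tab_act h (tab_act g t).
Proof. by apply/ffunP=> p; apply/setP=> x; rewrite !in_tab_act permM. Qed.

Lemma tab_act_is_tabloid g a t : is_tabloid a t -> is_tabloid a (tab_act g t).
Proof.
case/and3P=> /forallP dis /eqP cov /forallP card; apply/and3P; split.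
- apply/forallP=> p; apply/forallP=> q; apply/implyP=> npq.
  have /implyP/(_ npq)/pred0P d0 := forallP (dis p) q.
  by apply/pred0P=> x; have := d0 (g x); rewrite /= !in_tab_act.
- apply/eqP/setP=> x; rewrite inE; apply/bigcupP.
  have : g x \in \bigcup_p t p by rewrite cov inE.
  by case/bigcupP=> p _ gx; exists p; rewrite ?in_tab_act.
- by apply/forallP=> p; rewrite ffunE card_imset //; apply: perm_inj.
Qed.

Lemma tab_move_is_tabloid p q k a t : p != q -> k \in t q ->
  is_tabloid a t -> is_tabloid (a + unit_shape p - unit_shape q) (tab_move p k t).
Proof.
move=> npq kq /and3P[/forallP dis /eqP cov /forallP card].
have kN r : r != q -> k \notin t r.
  move=> nrq; have /implyP/(_ nrq)/pred0P/(_ k) := forallP (dis r) q.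
  by rewrite /= kq andbT => ->.
apply/and3P; split.
- apply/forallP=> r; apply/forallP=> s; apply/implyP=> nrs.
  have /implyP/(_ nrs)/pred0P d0 := forallP (dis r) s.
  apply/pred0P=> x; have /= := d0 x; rewrite !ffunE.
  case: (eqVneq r p) (eqVneq s p) nrs => [->|_] [->|_]; rewrite ?eqxx // !inE;
    by case: (eqVneq x k) => //= _; rewrite ?andbF.
- apply/eqP/setP=> x; rewrite inE; apply/bigcupP.
  case: (eqVneq x k) => [->|nxk]; first by exists p; rewrite // ffunE eqxx !inE eqxx.
  have : x \in \bigcup_p t p by rewrite cov inE.
  case/bigcupP=> r _ xr; exists r; rewrite // ffunE.
  by case: ifP; rewrite !inE ?nxk ?xr ?orbT.
- apply/forallP=> r; rewrite !ffunE -(eqP (card r)).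
  case: (eqVneq r p) => [->|nrp].
    by rewrite cardsU1 (kN _ npq) (negPf npq) subr0 addnC PoszD.
  case: (eqVneq r q) => [->|nrq]; last first.
    by rewrite addr0 subr0 (cardsD1 k (t r)) (negPf (kN _ nrq)).
  by rewrite (cardsD1 k (t q)) kq addr0 PoszD addrC addrA subrr add0r.
Qed.
End Tabloids.

Section PermutationModule.
Variables (C : fieldType) (d : nat) (I : finType).
Implicit Types (a b : tshape I) (t : {ffun I -> {set 'I_d}}).

Definition pmod_space a : vectType C := {ffun tabloid d a -> C^o}.

(* the basis vector of the tabloid t, and 0 if t is not an a-tabloid *)
Definition tvec a t : pmod_space a := [ffun T => (val T == t)%:R].

Definition tab_lin a (V : vectType C) (f : tabloid d a -> V) :
    'Hom(pmod_space a, V) :=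
  linfun (fun u : pmod_space a => \sum_T (u T : C) *: f T).

Lemma tab_linE a (V : vectType C) (f : tabloid d a -> V) u :
  tab_lin f u = \sum_T (u T : C) *: f T.
Proof.
rewrite /tab_lin linfunE // => c v w.
rewrite scaler_sumr -big_split /=; apply: eq_bigr => T _.
by rewrite !ffunE scalerDl scalerA.
Qed.

Lemma tab_lin_tvec a (V : vectType C) (f : tabloid d a -> V) T :
  tab_lin f (tvec a (val T)) = f T.
Proof.
rewrite tab_linE (bigD1 T) //= ffunE eqxx scale1r big1 ?addr0 // => T' nT.
by rewrite ffunE val_eqE (negPf nT) scale0r.
Qed.

Lemma tvec_ext a (V : vectType C) (f g : 'Hom(pmod_space a, V)) :
  (forall T : tabloid d a, f (tvec a (val T)) = g (tvec a (val T))) -> f = g.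
Proof.
move=> fg; apply/lfunP=> u.
have -> : u = \sum_T (u T : C) *: tvec a (val T).
  apply/ffunP=> T; rewrite sum_ffunE (bigD1 T) //= !ffunE eqxx.
  rewrite big1 ?addr0 => [|T' nT]; first by rewrite /GRing.scale /= mulr1.
  by rewrite !ffunE val_eqE eq_sym (negPf nT) scaler0.
by rewrite !linear_sum; apply: eq_bigr => T _; rewrite !linearZ /= fg.
Qed.

Definition pmod_act a (g : 'S_d) : 'End(pmod_space a) :=
  tab_lin (fun T => tvec a (tab_act g (val T))).

Lemma pmod_actE a g t : is_tabloid a t ->
  pmod_act a g (tvec a t) = tvec a (tab_act g t).
Proof. by move=> ta; have := tab_lin_tvec _ (Sub t ta); rewrite SubK => ->. Qed.

Fact pmod_act1 a : pmod_act a 1%g = \1%VF.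
Proof.
by apply: tvec_ext => T; rewrite (pmod_actE _ (valP T)) tab_act1 id_lfunE.
Qed.

Fact pmod_actM a g h : pmod_act a (h * g)%g = (pmod_act a h \o pmod_act a g)%VF.
Proof.
apply: tvec_ext => T; rewrite comp_lfunE !(pmod_actE _ (valP T)).
by rewrite pmod_actE ?tab_act_is_tabloid ?(valP T) // tab_actM.
Qed.

(* The module M^a, with action (T g)^p = g^-1 (T^p) on tabloids. *)
Definition pmod a : rep C d := Rep (@pmod_act1 a) (@pmod_actM a).

(* The value at T is the sum over k in T^q of T with k moved to cell p; the target
   shape b is meant to be a + unit_shape p - unit_shape q. *)
Definition pmod_move (p q : I) a b : 'Hom(pmod a, pmod b) :=
  tab_lin (fun T => \sum_(k in val T q) tvec b (tab_move p k (val T))).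

Lemma tab_act_move g p k t :
  tab_act g (tab_move p (g k) t) = tab_move p k (tab_act g t).
Proof.
apply/ffunP=> r; apply/setP=> x; rewrite in_tab_act !ffunE.
by case: eqP; rewrite !inE (inj_eq perm_inj) -in_tab_act ffunE.
Qed.

Lemma pmod_move_hom p q a b :
  p != q -> b = a + unit_shape p - unit_shape q -> rep_hom (pmod_move p q a b).
Proof.
move=> npq -> g; apply: tvec_ext => T; rewrite !comp_lfunE /=.
rewrite (pmod_actE _ (valP T)) /pmod_move tab_lin_tvec linear_sum /=.
have := tab_lin_tvec (fun T : tabloid d a => \sum_(k in val T q)
  tvec (a + unit_shape p - unit_shape q) (tab_move p k (val T)))
  (Sub _ (tab_act_is_tabloid g (valP T))).
rewrite SubK => ->; rewrite [in RHS](reindex_inj (@perm_inj _ g)) /=.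
apply: eq_big => [k|k]; first by rewrite in_tab_act.
rewrite in_tab_act => kT.
by rewrite pmod_actE ?tab_act_move //; apply: tab_move_is_tabloid (valP T).
Qed.

End PermutationModule.

Section EF.
Variables (C : fieldType) (d : nat).

(* j : 'I_m.-1 stands for the positions j and j + 1 of a sequence of length m *)
Definition pos0 m (j : 'I_m.-1) : 'I_m := widen_ord (leq_pred m) j.
Fact pos1_proof m (j : 'I_m.-1) : (j.+1 < m)%N.
Proof. by case: m j => [|m] [j]. Qed.
Definition pos1 m (j : 'I_m.-1) : 'I_m := Ordinal (pos1_proof j).

Definition alpha m (j : 'I_m.-1) : tshape 'I_m :=
  unit_shape (pos0 j) - unit_shape (pos1 j).

Definition opE m (j : 'I_m.-1) (a : tshape 'I_m) :
    'Hom(pmod C d a, pmod C d (a + alpha j)) :=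
  pmod_move C d (pos0 j) (pos1 j) a _.

Definition opF m (j : 'I_m.-1) (a : tshape 'I_m) :
    'Hom(pmod C d a, pmod C d (a - alpha j)) :=
  pmod_move C d (pos1 j) (pos0 j) a _.

Lemma pos_neq m (j : 'I_m.-1) : pos0 j != pos1 j.
Proof. by rewrite -val_eqE /= neq_ltn ltnSn. Qed.

Lemma opE_hom m (j : 'I_m.-1) a : rep_hom (opE j a).
Proof. by apply: pmod_move_hom (pos_neq j) _; rewrite addrA. Qed.

Lemma opF_hom m (j : 'I_m.-1) a : rep_hom (opF j a).
Proof.
by apply: pmod_move_hom; rewrite 1?eq_sym ?pos_neq // opprB addrA.
Qed.

Section Matrices.
Variables (m n : nat) (i : 'I_m) (j : 'I_n.-1) (a : tshape ('I_m * 'I_n)).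

Definition mopE : 'Hom(pmod C d a,
    pmod C d (a + unit_shape (i, pos0 j) - unit_shape (i, pos1 j))) :=
  pmod_move C d (i, pos0 j) (i, pos1 j) a _.

Definition mopF : 'Hom(pmod C d a,
    pmod C d (a - unit_shape (i, pos0 j) + unit_shape (i, pos1 j))) :=
  pmod_move C d (i, pos1 j) (i, pos0 j) a _.

Lemma mopE_hom : rep_hom mopE.
Proof. by apply: pmod_move_hom => //; rewrite xpair_eqE eqxx pos_neq. Qed.

Lemma mopF_hom : rep_hom mopF.
Proof.
apply: pmod_move_hom; first by rewrite xpair_eqE eqxx eq_sym pos_neq.
by rewrite addrAC.
Qed.
End Matrices.
End EF.

Section Margins.
Variables (C : fieldType) (d m n : nat) (a : tshape 'I_m) (b : tshape 'I_n).

(* The matrices with entries in N, row sums a and column sums b.  When a and b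
   have sum d, no entry exceeds d, so that the bound is harmless. *)
Definition has_margins (A : 'M['I_d.+1]_(m, n)) : bool :=
  [forall i, (\sum_j (A i j : nat))%N%:Z == a i]
  && [forall j, (\sum_i (A i j : nat))%N%:Z == b j].

Definition margin_mx : Type := {A : 'M['I_d.+1]_(m, n) | has_margins A}.
HB.instance Definition _ := SubFinite.on margin_mx.

Definition mxshape (A : margin_mx) : tshape ('I_m * 'I_n) :=
  [ffun p => (val A p.1 p.2 : nat)%:Z].

Definition mxsum : rep C d := dsum_rep (fun A : margin_mx => pmod C d (mxshape A)).

Definition mxproj (A : margin_mx) : 'Hom(mxsum, pmod C d (mxshape A)) :=
  dproj (fun A : margin_mx => pmod C d (mxshape A)) A.
Definition mxinj (A : margin_mx) : 'Hom(pmod C d (mxshape A), mxsum) :=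
  dinj (fun A : margin_mx => pmod C d (mxshape A)) A.

(* the basis vector of mxsum given by the tabloid t, in the summand indexed by
   the shape of t; it is 0 if t is not a tabloid of one of these shapes *)
Definition mxsum_vec (t : {ffun 'I_m * 'I_n -> {set 'I_d}}) : mxsum :=
  \sum_A mxinj A (tvec C (mxshape A) t).

(* the inclusion of the summand M^c, and 0 if c is not one of the indices *)
Definition mxincl (c : tshape ('I_m * 'I_n)) : 'Hom(pmod C d c, mxsum) :=
  tab_lin (fun T => mxsum_vec (val T)).

Lemma mxshape_inj : injective mxshape.
Proof.
move=> A B /ffunP eAB; apply/val_inj/matrixP=> i j; apply/val_inj.
by have := eAB (i, j); rewrite !ffunE => -[].
Qed.

Lemma mxsum_vecE A t : is_tabloid (mxshape A) t ->
  mxsum_vec t = mxinj A (tvec C (mxshape A) t).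
Proof.
move=> tA; rewrite /mxsum_vec (bigD1 A) //= big1 ?addr0 // => B nBA.
suff -> : tvec C (mxshape B) t = 0 by rewrite linear0.
apply/ffunP=> T; rewrite !ffunE; case: eqP => // eT.
case/negP: nBA; apply/eqP/mxshape_inj/ffunP=> p.
have /and3P[_ _ /forallP/(_ p)/eqP<-] := valP T.
by have /and3P[_ _ /forallP/(_ p)/eqP<-] := tA; rewrite -eT.
Qed.

Lemma mxinclE A : mxincl (mxshape A) = mxinj A.
Proof.
by apply: tvec_ext => T; rewrite tab_lin_tvec (mxsum_vecE (valP T)).
Qed.

(* T (x) T' |-> the tabloid with (i, j)-cell T^i :&: T'^j *)
Definition tens_rows : 'Hom(tensor_rep (pmod C d a) (pmod C d b), mxsum) :=
  tlift (fun (u : pmod C d a) (v : pmod C d b) =>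
    \sum_T \sum_T' (u T * v T' : C) *:
      mxsum_vec [ffun p => val T p.1 :&: val T' p.2]).

(* T (x) T' |-> the tabloid with (i, j)-cell T^j :&: T'^i *)
Definition tens_cols : 'Hom(tensor_rep (pmod C d b) (pmod C d a), mxsum) :=
  tlift (fun (u : pmod C d b) (v : pmod C d a) =>
    \sum_T \sum_T' (u T * v T' : C) *:
      mxsum_vec [ffun p => val T p.2 :&: val T' p.1]).
End Margins.

Section TensTabloids.
Variables (C : fieldType) (d m n : nat) (a : tshape 'I_m) (b : tshape 'I_n).

Lemma tab_bilin (I J : finType) (c : tshape I) (e : tshape J) (V : vectType C)
    (f : tabloid d c -> tabloid d e -> V) T T' :
  tlift (fun (u : pmod C d c) (v : pmod C d e) =>
      \sum_T \sum_T' (u T * v T' : C) *: f T T')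
    (tens (tvec C c (val T)) (tvec C e (val T'))) = f T T'.
Proof.
rewrite tliftE; last first.
  split=> [v x u u'|u x v v']; rewrite scaler_sumr -big_split;
    apply: eq_bigr => S _; rewrite scaler_sumr -big_split;
    apply: eq_bigr => S' _; rewrite /= !ffunE scalerA -scalerDl; congr (_ *: _).
    by rewrite mulrDl mulrA.
  by rewrite mulrDr mulrCA.
rewrite (bigD1 T) //= (bigD1 T') //= !ffunE !eqxx mulr1 scale1r.
rewrite [X in _ + X + _]big1 => [|S' nS]; last first.
  by rewrite !ffunE val_eqE (negPf nS) mulr0 scale0r.
rewrite big1 ?addr0 // => S nS; rewrite big1 // => S' _.
by rewrite !ffunE val_eqE (negPf nS) mul0r scale0r.
Qed.

Lemma tens_rowsE (T : tabloid d a) (T' : tabloid d b) :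
  tens_rows C d a b (tens (tvec C a (val T)) (tvec C b (val T'))) =
  mxsum_vec C a b [ffun p => val T p.1 :&: val T' p.2].
Proof. exact: tab_bilin. Qed.

Lemma tens_colsE (T : tabloid d b) (T' : tabloid d a) :
  tens_cols C d a b (tens (tvec C b (val T)) (tvec C a (val T'))) =
  mxsum_vec C a b [ffun p => val T p.2 :&: val T' p.1].
Proof. exact: tab_bilin. Qed.
End TensTabloids.

(* Under the isomorphisms r : X -> X' and s : Y -> Y', the map f is g. *)
Definition identified (C : fieldType) (d : nat) (X X' Y Y' : rep C d)
    (r : 'Hom(X, X')) (s : 'Hom(Y, Y')) (f : 'Hom(X, Y)) (g : 'Hom(X', Y')) :
    Prop :=
  [/\ rep_isom r, rep_isom s & (s \o f = g \o r)%VF].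

Definition is_intpart (d : nat) (s : seq nat) : bool :=
  [&& sorted geq s, 0%N \notin s & sumn s == d].
Record intpart (d : nat) := IntPart { intpart_seq :> seq nat; _ : is_intpart d intpart_seq }.
HB.instance Definition _ d := [isSub for @intpart_seq d].
HB.instance Definition _ d := [Choice of intpart d by <:].

Definition pshape d (l : intpart d) : tshape 'I_(size l) :=
  [ffun i => (tnth (in_tuple l) i)%:Z].

(* An object of the skeletal category Prm(S_d) is given by a finite multiset of
   partitions of d, and stands for the direct sum of the corresponding M^l; as
   the subcategory is full, the morphisms are those of representations. *)
Definition prm (d : nat) : choiceType := {mset intpart d}%mset.

Definition prm_rep (C : fieldType) d (X : prm d) : rep C d :=
  dsum_rep (fun k : 'I_(size (enum_mset X)) =>
    pmod C d (pshape (tnth (in_tuple (enum_mset X)) k))).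

(* l is obtained from the entries of a by deleting zeros and reordering *)
Definition sorts_to d (I : finType) (a : tshape I) (l : intpart d) : Prop :=
  perm_eq [seq c%:Z | c <- l] [seq a p | p <- enum I & a p != 0].

(* Main.v *)
Require Import Defs.
From HB Require Import structures.
From mathcomp Require Import all_boot all_order all_algebra all_fingroup.
From mathcomp Require Import finmap multiset reals complex.

Set Implicit Arguments.
Unset Strict Implicit.
Unset Printing Implicit Defensive.

Import GRing.Theory.
Local Open Scope ring_scope.

(** A tabloid with cells indexed by [I] is the family of fibres of a colouring
    c : {1, ..., d} -> I, and its shape records the sizes of the fibres.  A pair
    (T, T') of tabloids is thus a pair of colourings (c, c'), which is one
    colouring by I x J: its fibres are the overlaps of the cells of T and T',
    and the sizes of the overlaps form a matrix A whose margins are the two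
    shapes.  Conversely, a colouring by I x J is recovered from its two
    components, whose shapes are the margins of A.  Hence M^a (x) M^b is the
    direct sum of the M^A ([tens_rows_isom]); exchanging the factors gives the
    transposed form ([tens_cols_swap]).

    To move k in the second tabloid from cell q to cell p is to move it, in the
    matrix tabloid, from (i, q) to (i, p), where i is the row of k, that is, its
    cell in the first tabloid.  Sorting the moves by i turns 1 (x) E_j and
    1 (x) F_j into the sums over the rows i ([tens_rows_move]), and exchanging
    the factors gives E_j (x) 1 and F_j (x) 1 ([tens_cols_move]).

    M^A depends on A only up to empty cells and the order of the cells
    ([pmod_iso_cells]), so that it is the module of the partition obtained by
    sorting A.  Since the tensor product distributes over direct sums
    ([tensor_dsum]) and iterated direct sums can be flattened ([dsum_dsum]),
    tensor products of sums of modules of partitions are again such sums. *)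

(** * Isomorphisms and direct sums of representations *)

Section RepIsomorphisms.
Variables (C : fieldType) (d : nat).
Implicit Types X Y Z : rep C d.

Lemma rep_hom_apply X Y (f : 'Hom(X, Y)) g x :
  rep_hom f -> f (rep_act X g x) = rep_act Y g (f x).
Proof. by move=> /(_ g)/lfunP/(_ x); rewrite !comp_lfunE. Qed.

Lemma rep_hom_comp X Y Z (f : 'Hom(X, Y)) (h : 'Hom(Y, Z)) :
  rep_hom f -> rep_hom h -> rep_hom (X := X) (Y := Z) (h \o f)%VF.
Proof. by move=> hf hh g; rewrite -comp_lfunA hf !comp_lfunA hh. Qed.

Lemma rep_hom_sum X Y (I : finType) (f : I -> 'Hom(X, Y)) :
  (forall i, rep_hom (f i)) -> rep_hom (\sum_i f i).
Proof.
move=> hf g; apply/lfunP=> x; rewrite !comp_lfunE !sum_lfunE linear_sum.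
by apply: eq_bigr => i _; apply: rep_hom_apply.
Qed.

Lemma can_rep_isom X Y (f : 'Hom(X, Y)) (h : 'Hom(Y, X)) :
  rep_hom f -> (h \o f)%VF = \1%VF -> (f \o h)%VF = \1%VF -> rep_isom f.
Proof.
move=> hf /lfunP hfK /lfunP hK; split=> //.
by exists h => x; [have := hfK x | have := hK x]; rewrite comp_lfunE id_lfunE.
Qed.

Lemma rep_isom_comp X Y Z (f : 'Hom(X, Y)) (h : 'Hom(Y, Z)) :
  rep_isom f -> rep_isom h -> rep_isom (X := X) (Y := Z) (h \o f)%VF.
Proof.
move=> [hf bf] [hh bh]; split; first exact: rep_hom_comp.
by apply: (eq_bij (bij_comp bh bf)) => x; rewrite /= comp_lfunE.
Qed.

Lemma rep_isom_inv X Y (f : 'Hom(X, Y)) : rep_isom f ->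
  [/\ rep_hom (X := Y) (Y := X) (f^-1)%VF,
      cancel f (f^-1)%VF & cancel (f^-1)%VF f].
Proof.
move=> [hf [f' fK f'K]].
have fVK : cancel f (f^-1)%VF by apply/lker0_lfunK/lker0P/(can_inj fK).
have VfK : cancel (f^-1)%VF f by move=> y; rewrite -[y]f'K fVK.
split=> // g; apply/lfunP=> y; apply: (can_inj fK).
by rewrite !comp_lfunE VfK (rep_hom_apply _ _ hf) VfK.
Qed.

Lemma rep_iso_refl X : rep_iso X X.
Proof.
exists \1%VF; apply: (@can_rep_isom _ _ _ \1%VF); rewrite ?comp_lfun1r //.
by move=> g; rewrite comp_lfun1r comp_lfun1l.
Qed.

Lemma rep_iso_sym X Y : rep_iso X Y -> rep_iso Y X.
Proof.
case=> f /rep_isom_inv[hV fK VK].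
by exists (f^-1)%VF; split=> //; exists f.
Qed.

Lemma rep_iso_trans Y X Z : rep_iso X Y -> rep_iso Y Z -> rep_iso X Z.
Proof. by case=> f hf [h hh]; exists (h \o f)%VF; apply: rep_isom_comp. Qed.

Section DirectSums.
Variables (I : finType) (X : I -> rep C d).

Lemma sum_dinj_dproj (u : dsum X) : \sum_i dinj X i (dproj X i u) = u.
Proof.
apply/ffunP=> j; rewrite -2!dprojE linear_sum (bigD1 j) //= dinjK.
by rewrite big1 ?addr0 // => i nij; rewrite dinj_neq.
Qed.

Lemma dinj_hom i : rep_hom (X := X i) (Y := dsum_rep X) (dinj X i).
Proof.
move=> g; apply/lfunP=> x; rewrite !comp_lfunE /= dsum_actE.
apply/ffunP=> j; rewrite ffunE -2!dprojE.
have [<-|nij] := eqVneq i j; first by rewrite !dinjK.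
by rewrite !dinj_neq // linear0.
Qed.

Lemma dproj_hom i : rep_hom (X := dsum_rep X) (Y := X i) (dproj X i).
Proof.
by move=> g; apply/lfunP=> x; rewrite !comp_lfunE /= dsum_actE !dprojE ffunE.
Qed.

(** A direct sum is recognized by its structure maps; each comparison of direct
    sums below exhibits such a system of inclusions and projections. *)
Lemma rep_iso_dsum Y (inj : forall i, 'Hom(X i, Y))
    (prj : forall i, 'Hom(Y, X i)) :
    (forall i, rep_hom (inj i)) ->
    (forall i x, prj i (inj i x) = x) ->
    (forall i j x, i != j -> prj j (inj i x) = 0) ->
    (forall y, \sum_i inj i (prj i y) = y) ->
  rep_iso Y (dsum_rep X).
Proof.
move=> hinj injK inj0 sumE; apply: rep_iso_sym.
exists (\sum_i (inj i \o dproj X i)%VF).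
apply: (can_rep_isom (X := dsum_rep X) (Y := Y)
  (h := \sum_i (dinj X i \o prj i)%VF)).
- by apply: rep_hom_sum => i; apply: rep_hom_comp (dproj_hom i) (hinj i).
- apply/lfunP=> u; rewrite comp_lfunE id_lfunE !sum_lfunE.
  rewrite -[RHS]sum_dinj_dproj; apply: eq_bigr => i _.
  rewrite comp_lfunE linear_sum (bigD1 i) //= comp_lfunE injK.
  by rewrite big1 ?addr0 // => j nji; rewrite comp_lfunE inj0.
- apply/lfunP=> y; rewrite comp_lfunE id_lfunE !sum_lfunE.
  rewrite -[RHS]sumE; apply: eq_bigr => i _.
  rewrite comp_lfunE linear_sum (bigD1 i) //= comp_lfunE dinjK.
  by rewrite big1 ?addr0 // => j nji; rewrite comp_lfunE dinj_neq.
Qed.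
End DirectSums.

Lemma dsum_reindex (I K : finType) (h : K -> I) (X : I -> rep C d)
    (Y : K -> rep C d) :
  bijective h -> (forall k, rep_iso (X (h k)) (Y k)) ->
  rep_iso (dsum_rep X) (dsum_rep Y).
Proof.
move=> bh isoXY.
have [f isof] := fin_all_exists (fun k => rep_iso_sym (isoXY k)).
have fV k := rep_isom_inv (isof k).
apply: (rep_iso_dsum (Y := dsum_rep X)
  (inj := fun k => (dinj X (h k) \o f k)%VF)
  (prj := fun k => ((f k)^-1 \o dproj X (h k))%VF)).
- by move=> k; apply: rep_hom_comp (dinj_hom X (h k)); case: (isof k).
- by move=> k y; rewrite !comp_lfunE dinjK; have [_ ->] := fV k.
- move=> k l y nkl; rewrite !comp_lfunE dinj_neq ?linear0 //.
  by rewrite (inj_eq (bij_inj bh)).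
move=> u; rewrite -[RHS]sum_dinj_dproj [RHS](reindex h) /=; last exact: onW_bij.
by apply: eq_bigr => k _; rewrite !comp_lfunE; have [_ _ ->] := fV k.
Qed.

Lemma dsum_dsum (I : finType) (J : I -> finType)
    (X : forall i, J i -> rep C d) :
  rep_iso (dsum_rep (fun i => dsum_rep (@X i)))
          (dsum_rep (fun p : {i : I & J i} => X (tag p) (tagged p))).
Proof.
pose D := dsum_rep (fun i => dsum_rep (@X i)).
pose P (p : {i : I & J i}) := X (tag p) (tagged p).
apply: (rep_iso_dsum (X := P) (Y := D)
  (inj := fun p => (dinj (fun i => dsum_rep (@X i)) (tag p)
                    \o dinj (@X (tag p)) (tagged p))%VF)
  (prj := fun p => (dproj (@X (tag p)) (tagged p)
                    \o dproj (fun i => dsum_rep (@X i)) (tag p))%VF)).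
- by move=> p; apply: (rep_hom_comp (X := P p) (Z := D)
    (dinj_hom (@X (tag p)) _) (dinj_hom (fun i => dsum_rep (@X i)) _)).
- by move=> p x; rewrite !comp_lfunE !dinjK.
- move=> [i j] [i' j'] /= x; rewrite !comp_lfunE.
  have [ii'|nii' _] := eqVneq i i'; last by rewrite dinj_neq ?linear0.
  case: i' / ii' j' => j' njj'; rewrite dinjK dinj_neq //.
  by apply: contraNneq njj' => /= ->.
move=> u; rewrite -[RHS]sum_dinj_dproj.
transitivity (\sum_i \sum_j (dinj (fun i => dsum_rep (@X i)) i
     (dinj (@X i) j (dproj (@X i) j (dproj (fun i => dsum_rep (@X i)) i u))))).
  rewrite sig_big_dep /=.
  by apply: eq_bigr => -[i j] _; rewrite !comp_lfunE.
by apply: eq_bigr => i _; rewrite -linear_sum sum_dinj_dproj.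
Qed.

Lemma tens_suml (V W : vectType C) (I : finType) (P : pred I) (v : I -> V)
    (w : W) :
  tens (\sum_(i | P i) v i) w = \sum_(i | P i) tens (v i) w :> tensor V W.
Proof.
have [lw _] := tens_bilinear V W.
by rewrite -(linfunE (lw w)) linear_sum; apply: eq_bigr => i _;
  rewrite /= linfunE.
Qed.

Lemma tens_sumr (V W : vectType C) (I : finType) (P : pred I) (v : V)
    (w : I -> W) :
  tens v (\sum_(i | P i) w i) = \sum_(i | P i) tens v (w i) :> tensor V W.
Proof.
have [_ lv] := tens_bilinear V W.
by rewrite -(linfunE (lv v)) linear_sum; apply: eq_bigr => i _;
  rewrite /= linfunE.
Qed.

Lemma tmap0l (V V' W W' : vectType C) (g : 'Hom(W, W')) :
  tmap (0 : 'Hom(V, V')) g = 0.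
Proof.
apply: tens_ext => v w; rewrite tmapE !lfunE /=.
by apply/matrixP=> i j; rewrite !mxE linear0 mul0r.
Qed.

Lemma tmap0r (V V' W W' : vectType C) (f : 'Hom(V, V')) :
  tmap f (0 : 'Hom(W, W')) = 0.
Proof.
apply: tens_ext => v w; rewrite tmapE !lfunE /=.
by apply/matrixP=> i j; rewrite !mxE linear0 mulr0.
Qed.

(** The structure maps of the direct sum are the tensor products of those of the
    two factors; that they decompose the identity is bilinearity. *)
Lemma tensor_dsum (I J : finType) (X : I -> rep C d) (Y : J -> rep C d) :
  rep_iso (tensor_rep (dsum_rep X) (dsum_rep Y))
          (dsum_rep (fun p : I * J => tensor_rep (X p.1) (Y p.2))).
Proof.
apply: (rep_iso_dsum (Y := tensor_rep (dsum_rep X) (dsum_rep Y))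
  (X := fun p : I * J => tensor_rep (X p.1) (Y p.2))
  (inj := fun p => tmap (dinj X p.1) (dinj Y p.2))
  (prj := fun p => tmap (dproj X p.1) (dproj Y p.2))).
- by move=> p; apply: tmap_hom; apply: dinj_hom.
- move=> p t; rewrite -comp_lfunE -tmap_comp.
  have idX (K : finType) (Z : K -> rep C d) k :
    (dproj Z k \o dinj Z k)%VF = \1%VF.
    by apply/lfunP=> x; rewrite comp_lfunE dinjK id_lfunE.
  by rewrite !idX tmap_id id_lfunE.
- move=> p q t npq; rewrite -comp_lfunE -tmap_comp.
  have zX (K : finType) (Z : K -> rep C d) k l : k != l ->
    (dproj Z l \o dinj Z k)%VF = 0.
    by move=> nkl; apply/lfunP=> x; rewrite comp_lfunE dinj_neq // lfunE.
  have [e1|n1] := eqVneq p.1 q.1; last by rewrite zX // tmap0l lfunE.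
  have [e2|n2] := eqVneq p.2 q.2; last first.
    by rewrite [X in tmap _ X]zX // tmap0r lfunE.
  by case/eqP: npq; apply: injective_projections.
move=> t; rewrite -[RHS]id_lfunE.
under eq_bigr do rewrite -comp_lfunE.
rewrite -sum_lfunE; congr (fun_of_lfun _ t); apply: tens_ext => u v.
rewrite sum_lfunE id_lfunE.
rewrite -{2}(sum_dinj_dproj u) -{2}(sum_dinj_dproj v) tens_suml.
under [RHS]eq_bigr do rewrite tens_sumr.
by rewrite pair_bigA; apply: eq_bigr => p _; rewrite comp_lfunE !tmapE.
Qed.

End RepIsomorphisms.

(** * The exchange of tensor factors *)

Section Swap.
Variable C : fieldType.
Implicit Types V W U : vectType C.

Definition swap V W : 'Hom(tensor V W, tensor W V) :=
  tlift (fun v w => tens w v).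

Lemma swapE V W v w : swap V W (tens v w) = tens w v.
Proof.
have [tl tr] := tens_bilinear W V.
apply: (tliftE (b := fun v w => tens w v)).
by split=> [y|y]; [apply: tr | apply: tl].
Qed.

Lemma swapK V W : (swap W V \o swap V W)%VF = \1%VF.
Proof. by apply: tens_ext => v w; rewrite comp_lfunE !swapE id_lfunE. Qed.

Lemma swap_tmap V V' W W' (f : 'Hom(V, V')) (g : 'Hom(W, W')) :
  (swap V' W' \o tmap f g)%VF = (tmap g f \o swap V W)%VF.
Proof. by apply: tens_ext => v w; rewrite !comp_lfunE !(swapE, tmapE). Qed.

Lemma swap_isom d (X Y : rep C d) :
  rep_isom (X := tensor_rep X Y) (Y := tensor_rep Y X) (swap X Y).
Proof.
apply: (can_rep_isom (X := tensor_rep X Y) (Y := tensor_rep Y X)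
  (h := swap Y X)); rewrite ?swapK //.
by move=> g; apply: swap_tmap.
Qed.
End Swap.

(** * Tabloids as colourings *)

Section Colourings.
Variables (d : nat) (I : finType).
Implicit Types (a : tshape I) (c : 'I_d -> I).

Definition tab_of c : {ffun I -> {set 'I_d}} := [ffun p => [set x | c x == p]].

Lemma eq_tab_of c c' : c =1 c' -> tab_of c = tab_of c'.
Proof. by move=> e; apply/ffunP=> p; apply/setP=> x; rewrite !ffunE !inE e. Qed.

(** The fibres of a colouring are disjoint and cover everything, so that only
    their sizes are left to check. *)
Lemma is_tab_of a c :
  is_tabloid a (tab_of c) = [forall p, #|[set x | c x == p]|%:Z == a p].
Proof.
rewrite /is_tabloid.
have -> : [forall p, forall q, (p != q) ==> [disjoint tab_of c p & tab_of c q]].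
  apply/forallP=> p; apply/forallP=> q; apply/implyP=> npq.
  apply/pred0P=> x; rewrite /= !ffunE !inE.
  by apply/negP=> /andP[/eqP ep /eqP eq]; rewrite -ep -eq eqxx in npq.
have -> : \bigcup_p tab_of c p == [set: 'I_d].
  apply/eqP/setP=> x; rewrite inE; apply/bigcupP.
  by exists (c x); rewrite // ffunE inE.
by apply: eq_forallb => p; rewrite ffunE.
Qed.

Lemma card_tab_of a c p : is_tabloid a (tab_of c) ->
  #|[set x | c x == p]|%:Z = a p.
Proof. by rewrite is_tab_of => /forallP/(_ p)/eqP. Qed.

Lemma tab_ofP a t : is_tabloid a t -> exists c, t = tab_of c.
Proof.
case/and3P=> /forallP dis /eqP cov _.
have /fin_all_exists[c tc] : forall x : 'I_d, exists p, x \in t p.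
  move=> x; have : x \in \bigcup_p t p by rewrite cov inE.
  by case/bigcupP=> p _ tp; exists p.
exists c; apply/ffunP=> p; apply/setP=> x; rewrite ffunE inE.
have [<-|ncp] := eqVneq; first by rewrite tc.
have /implyP/(_ ncp)/pred0P/(_ x) := forallP (dis (c x)) p.
by rewrite /= tc.
Qed.

Lemma tab_act_of g c : tab_act g (tab_of c) = tab_of (c \o g).
Proof.
by apply/ffunP=> p; apply/setP=> x; rewrite in_tab_act !ffunE !inE.
Qed.

Lemma tab_move_of p k c :
  tab_move p k (tab_of c) = tab_of (fun x => if x == k then p else c x).
Proof.
apply/ffunP=> q; apply/setP=> x; rewrite !ffunE.
have [->|nqp] := eqVneq q p; rewrite !inE; case: (eqVneq x k) => //= _.
  by rewrite eqxx.
by rewrite eq_sym (negPf nqp).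
Qed.
End Colourings.

Lemma tab_of_cap d (I J : finType) (c : 'I_d -> I) (c' : 'I_d -> J) :
  [ffun p : I * J => tab_of c p.1 :&: tab_of c' p.2]
    = tab_of (fun x => (c x, c' x)).
Proof.
by apply/ffunP=> -[i j]; apply/setP=> x; rewrite !ffunE !inE.
Qed.

Section Push.
Variables (d : nat) (I J : finType) (h : J -> I).

(** Cells with the same image under [h] are merged: along the projections of a
    product this takes the unions of the rows or of the columns, and along an
    injection it adds empty cells. *)
Definition tab_push (t : {ffun J -> {set 'I_d}}) : {ffun I -> {set 'I_d}} :=
  [ffun p => \bigcup_(j | h j == p) t j].

Lemma tab_push_of (c : 'I_d -> J) : tab_push (tab_of c) = tab_of (h \o c).
Proof.
apply/ffunP=> p; apply/setP=> x; rewrite !ffunE !inE.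
apply/bigcupP/idP => [[j /eqP<-]|hc]; first by rewrite ffunE inE /= => /eqP->.
by exists (c x); rewrite // ffunE inE.
Qed.

Lemma is_tab_push (a : tshape I) (b : tshape J) t :
  (forall p, a p = \sum_(j | h j == p) b j) ->
  is_tabloid b t -> is_tabloid a (tab_push t).
Proof.
move=> aE tb; have [c et] := tab_ofP tb; move: tb; rewrite {t}et => tb.
rewrite tab_push_of is_tab_of; apply/forallP=> p; rewrite aE.
under eq_bigr => j _ do rewrite -(card_tab_of j tb).
rewrite -(big_morph Posz PoszD (erefl 0%:Z)) eqz_nat -sum1_card.
rewrite (partition_big c (fun j => h j == p)) => [|x]; last by rewrite inE.
apply/eqP/eq_bigr => j /eqP hj; rewrite -sum1_card; apply: eq_bigl => x.
by rewrite !inE /=; have [->|_] := eqVneq (c x) j; rewrite ?hj ?eqxx ?andbF.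
Qed.
End Push.

(** * Permutation modules *)

Section PermutationModules.
Variables (C : fieldType) (d : nat).

Lemma tab_lin_val (I : finType) (a : tshape I) (V : vectType C)
    (f : {ffun I -> {set 'I_d}} -> V) t : is_tabloid a t ->
  tab_lin (fun T : tabloid d a => f (val T)) (tvec C a t) = f t.
Proof. by move=> ta; have := tab_lin_tvec _ (Sub t ta); rewrite SubK => ->. Qed.

Lemma tvec_of_ext (I : finType) (a : tshape I) (V : vectType C)
    (f g : 'Hom(pmod C d a, V)) :
  (forall c, is_tabloid a (tab_of c) ->
     f (tvec C a (tab_of c)) = g (tvec C a (tab_of c))) -> f = g.
Proof.
move=> fg; apply: tvec_ext => T; have [c eT] := tab_ofP (valP T).
by move: (valP T); rewrite eT; apply: fg.
Qed.

Lemma tens_tvec_ext (I J : finType) (a : tshape I) (b : tshape J)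
    (V : vectType C) (f g : 'Hom(tensor (pmod C d a) (pmod C d b), V)) :
  (forall c c', is_tabloid a (tab_of c) -> is_tabloid b (tab_of c') ->
     f (tens (tvec C a (tab_of c)) (tvec C b (tab_of c'))) =
     g (tens (tvec C a (tab_of c)) (tvec C b (tab_of c')))) -> f = g.
Proof.
move=> fg; have [tl tr] := tens_bilinear (pmod C d a) (pmod C d b).
have linl w (k : 'Hom(tensor (pmod C d a) (pmod C d b), V)) :
    linear (fun v => k (tens v w)).
  by move=> x u v; rewrite tl linearP.
have linr v (k : 'Hom(tensor (pmod C d a) (pmod C d b), V)) :
    linear (fun w => k (tens v w)).
  by move=> x u w; rewrite tr linearP.
apply: tens_ext => v w; rewrite -(linfunE (linl w f)) -(linfunE (linl w g)).
congr (fun_of_lfun _ v); apply: tvec_of_ext => c tc; rewrite !linfunE //.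
rewrite -(linfunE (linr _ f)) -(linfunE (linr _ g)).
congr (fun_of_lfun _ w); apply: tvec_of_ext => c' tc'; rewrite !linfunE //.
exact: fg.
Qed.

(** If the injection [h] only misses empty cells, then pushing a colouring along
    [h] is a bijection of tabloids that commutes with S_d: every point of a
    tabloid of shape [a] lies in a cell of positive size, hence in the image of
    [h]. *)
Lemma pmod_iso_cells (I J : finType) (h : J -> I) (a : tshape I)
    (b : tshape J) :
    injective h -> (forall j, b j = a (h j)) ->
    (forall p, a p != 0 -> exists j, h j = p) ->
  rep_iso (pmod C d a) (pmod C d b).
Proof.
move=> hI bE hS; apply: rep_iso_sym.
have push c : is_tabloid b (tab_of c) -> is_tabloid a (tab_of (h \o c)).
  rewrite -tab_push_of; apply: is_tab_push => p.
  have [a0|/hS[j <-]] := eqVneq (a p) 0.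
    by rewrite a0 big1 // => j /eqP ep; rewrite bE ep.
  by rewrite (big_pred1 j) // => i; rewrite /= (inj_eq hI).
have pull c : is_tabloid a (tab_of c) ->
    exists2 c', is_tabloid b (tab_of c') & c =1 h \o c'.
  move=> ac; have /fin_all_exists[c' cE] : forall x, exists j, h j = c x.
    move=> x; apply: hS; rewrite -(card_tab_of _ ac) eqz_nat -lt0n.
    by apply/card_gt0P; exists x; rewrite inE.
  exists c' => [|x]; last by rewrite /= cE.
  rewrite is_tab_of; apply/forallP=> j; rewrite bE -(card_tab_of _ ac) eqz_nat.
  by apply/eqP/eq_card => x; rewrite !inE -cE (inj_eq hI).
have pushK c : [ffun j => tab_of (h \o c) (h j)] = tab_of c.
  by apply/ffunP=> j; apply/setP=> x; rewrite !ffunE !inE (inj_eq hI).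
pose f := tab_lin (fun T : tabloid d b => tvec C a (tab_push h (val T))).
pose g := tab_lin (fun T : tabloid d a =>
  tvec C b [ffun j => val T (h j)]).
have fE c : is_tabloid b (tab_of c) ->
    f (tvec C b (tab_of c)) = tvec C a (tab_of (h \o c)).
  move=> bc; rewrite /f (tab_lin_val (fun t => _ (tab_push h t))) //.
  by rewrite tab_push_of.
have gE c : is_tabloid b (tab_of c) ->
    g (tvec C a (tab_of (h \o c))) = tvec C b (tab_of c).
  move=> bc; rewrite /g (tab_lin_val (fun t => tvec C b [ffun j => t (h j)])).
    by rewrite pushK.
  exact: push.
exists f; apply: (can_rep_isom (X := pmod C d b) (Y := pmod C d a) (h := g)).
- move=> s; apply: tvec_of_ext => c bc; rewrite !comp_lfunE fE //=.
  rewrite !pmod_actE ?tab_act_of ?fE ?push //.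
  by rewrite -tab_act_of tab_act_is_tabloid.
- by apply: tvec_of_ext => c bc; rewrite comp_lfunE id_lfunE fE ?gE.
- apply: tvec_of_ext => c /pull[c' bc' /eq_tab_of->].
  by rewrite comp_lfunE id_lfunE gE ?fE.
Qed.

(** * The sum over matrices with given margins *)

Section Margins.
Variables (m n : nat) (a : tshape 'I_m) (b : tshape 'I_n).

Lemma mxsum_ext (V : vectType C) (f g : 'Hom(mxsum C d a b, V)) :
  (forall (A : margin_mx d a b) c, is_tabloid (mxshape A) (tab_of c) ->
     f (mxsum_vec C a b (tab_of c)) = g (mxsum_vec C a b (tab_of c))) ->
  f = g.
Proof.
move=> fg; apply/lfunP=> u; rewrite -[u]sum_dinj_dproj !linear_sum.
apply: eq_bigr => A _.
have fgA : (f \o mxinj C A)%VF = (g \o mxinj C A)%VF.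
  apply: tvec_of_ext => c Ac; rewrite !comp_lfunE.
  by have := fg A c Ac; rewrite (mxsum_vecE _ Ac).
by have /lfunP/(_ (dproj _ A u)) := fgA; rewrite !comp_lfunE.
Qed.

Lemma mxsum_vec_act g (A : margin_mx d a b) (t : {ffun _ -> {set 'I_d}}) :
  is_tabloid (mxshape A) t ->
  rep_act (mxsum C d a b) g (mxsum_vec C a b t)
    = mxsum_vec C a b (tab_act g t).
Proof.
move=> At; rewrite !(@mxsum_vecE C d m n a b A) ?tab_act_is_tabloid //.
have homA := dinj_hom (fun B : margin_mx d a b => pmod C d (mxshape B)) A.
by rewrite -(rep_hom_apply _ _ homA) /= pmod_actE.
Qed.

Lemma tabloid_row (A : margin_mx d a b) (t : {ffun _ -> {set 'I_d}}) :
  is_tabloid (mxshape A) t ->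
  is_tabloid a (tab_push fst t).
Proof.
apply: is_tab_push => i; have /andP[/forallP/(_ i)/eqP<- _] := valP A.
rewrite (big_morph Posz PoszD (erefl 0%:Z)).
rewrite (reindex_onto (pair i) snd) => [|[k j] /eqP /= ->] //=.
by apply: eq_big => [j|j _]; rewrite ?ffunE ?eqxx.
Qed.

Lemma tabloid_col (A : margin_mx d a b) (t : {ffun _ -> {set 'I_d}}) :
  is_tabloid (mxshape A) t ->
  is_tabloid b (tab_push snd t).
Proof.
apply: is_tab_push => j; have /andP[_ /forallP/(_ j)/eqP<-] := valP A.
rewrite (big_morph Posz PoszD (erefl 0%:Z)).
rewrite (reindex_onto (pair^~ j) fst) => [|[i k] /eqP /= ->] //=.
by apply: eq_big => [i|i _]; rewrite ?ffunE ?eqxx.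
Qed.

Lemma sum_card_preim (K : finType) (S : {set 'I_d}) (f : 'I_d -> K) :
  (\sum_k #|[set x in S | f x == k]| = #|S|)%N.
Proof.
rewrite -sum1_card (partition_big f xpredT) //.
by apply: eq_bigr => k _; rewrite -sum1_card; apply: eq_bigl => x; rewrite inE.
Qed.

(** The sizes of the overlaps have the right margins because each cell of one
    tabloid is cut into pieces by the cells of the other. *)
Lemma tabloid_cap (c : 'I_d -> 'I_m) (c' : 'I_d -> 'I_n) :
  is_tabloid a (tab_of c) -> is_tabloid b (tab_of c') ->
  exists A : margin_mx d a b,
    is_tabloid (mxshape A) (tab_of (fun x => (c x, c' x))).
Proof.
move=> ac bc'.
(* An overlap is a subset of 'I_d, so its size survives [inord]. *)
pose M : 'M['I_d.+1]_(m, n) :=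
  \matrix_(i, j) inord #|[set x | (c x, c' x) == (i, j)]|.
have ME i j : M i j = #|[set x | (c x, c' x) == (i, j)]| :> nat.
  by rewrite mxE inordK // ltnS -[X in (_ <= X)%N]card_ord max_card.
have marginsM : has_margins a b M.
  apply/andP; split; apply/forallP.
    move=> i; rewrite -(card_tab_of i ac) eqz_nat -(sum_card_preim _ c').
    apply/eqP/eq_bigr => j _; rewrite ME; apply: eq_card => x.
    by rewrite !inE xpair_eqE.
  move=> j; rewrite -(card_tab_of j bc') eqz_nat -(sum_card_preim _ c).
  apply/eqP/eq_bigr => i _; rewrite ME; apply: eq_card => x.
  by rewrite !inE xpair_eqE andbC.
exists (Sub M marginsM); rewrite is_tab_of; apply/forallP=> -[i j].
by rewrite ffunE SubK ME.
Qed.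

Lemma tens_rows_of (c : 'I_d -> 'I_m) (c' : 'I_d -> 'I_n) :
  is_tabloid a (tab_of c) -> is_tabloid b (tab_of c') ->
  tens_rows C d a b (tens (tvec C a (tab_of c)) (tvec C b (tab_of c')))
    = mxsum_vec C a b (tab_of (fun x => (c x, c' x))).
Proof.
move=> ac bc; rewrite -tab_of_cap.
by have := tens_rowsE C (Sub _ ac : tabloid d a) (Sub _ bc : tabloid d b).
Qed.

(** The inverse sends a matrix tabloid to the tensor product of its row unions
    with its column unions. *)
Lemma tens_rows_isom : rep_isom (tens_rows C d a b).
Proof.
pose back t := tens (tvec C a (tab_push fst t)) (tvec C b (tab_push snd t))
  : tensor_rep (pmod C d a) (pmod C d b).
pose g := \sum_(A : margin_mx d a b)
  (tab_lin (fun T : tabloid d (mxshape A) => back (val T)) \o mxproj C A)%VF.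
have gE (A : margin_mx d a b) t :
    is_tabloid (mxshape A) t -> g (mxsum_vec C a b t) = back t.
  move=> At; rewrite (mxsum_vecE _ At) sum_lfunE (bigD1 A) //= comp_lfunE.
  rewrite dinjK tab_lin_val // big1 ?addr0 // => B nBA.
  by rewrite comp_lfunE dinj_neq ?linear0 // eq_sym.
apply: (can_rep_isom (h := g)).
- move=> s; apply: tens_tvec_ext => c c' ac bc'.
  rewrite !comp_lfunE /= /tensor_act tmapE tens_rows_of // !pmod_actE //.
  have [A Acc'] := tabloid_cap ac bc'.
  rewrite (mxsum_vec_act _ Acc') !tab_act_of tens_rows_of //.
    by rewrite -tab_act_of tab_act_is_tabloid.
  by rewrite -tab_act_of tab_act_is_tabloid.
- apply: tens_tvec_ext => c c' ac bc'; have [A Acc'] := tabloid_cap ac bc'.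
  by rewrite comp_lfunE id_lfunE tens_rows_of // (gE A) // /back !tab_push_of.
- apply: mxsum_ext => A c Ac; rewrite comp_lfunE id_lfunE (gE A) // /back.
  have := tabloid_row Ac; have := tabloid_col Ac.
  rewrite !tab_push_of => bc ac; rewrite tens_rows_of //.
Qed.
End Margins.

Lemma tens_cols_swap m n (a : tshape 'I_m) (b : tshape 'I_n) :
  tens_cols C d a b = (tens_rows C d a b \o swap _ _)%VF.
Proof.
apply: tens_tvec_ext => c c' bc ac'; rewrite comp_lfunE swapE.
have /= -> := tens_colsE C (Sub _ bc : tabloid d b) (Sub _ ac' : tabloid d a).
rewrite tens_rows_of // -tab_of_cap; congr mxsum_vec.
by apply/ffunP=> p; rewrite !ffunE setIC.
Qed.

Lemma tens_cols_isom m n (a : tshape 'I_m) (b : tshape 'I_n) :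
  rep_isom (tens_cols C d a b).
Proof.
rewrite tens_cols_swap.
exact: rep_isom_comp (swap_isom (pmod C d b) (pmod C d a)) (tens_rows_isom a b).
Qed.

Lemma pmod_move_of (I : finType) (p q : I) (a b : tshape I) c :
  is_tabloid a (tab_of c) ->
  pmod_move C d p q a b (tvec C a (tab_of c)) =
    \sum_(k | c k == q) tvec C b (tab_of (fun x => if x == k then p else c x)).
Proof.
move=> ac; rewrite /pmod_move.
rewrite (tab_lin_val (fun t => \sum_(k in t q) tvec C b (tab_move p k t))) //.
by apply: eq_big => [k|k _]; rewrite ?ffunE ?inE // tab_move_of.
Qed.

Lemma is_tab_move (I : finType) (p q : I) (a : tshape I) (c : 'I_d -> I) k :
  p != q -> c k = q -> is_tabloid a (tab_of c) ->
  is_tabloid (a + unit_shape p - unit_shape q)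
    (tab_of (fun x => if x == k then p else c x)).
Proof.
move=> npq ck ac; rewrite -tab_move_of; apply: tab_move_is_tabloid => //.
by rewrite ffunE inE ck.
Qed.

(** Moving [k] between two columns of the matrix keeps its row, which is the
    cell of [k] in the first tabloid; sorting the moves by this row gives the
    sum over the rows of the matrix.  The shapes [s A i] are a parameter because
    E_j adds the unit of the new cell before removing that of the old one, and
    F_j does so in the opposite order. *)
Lemma tens_rows_move m n (a : tshape 'I_m) (b b' : tshape 'I_n) (p q : 'I_n)
    (s : margin_mx d a b -> 'I_m -> tshape ('I_m * 'I_n)) :
    p != q -> b' = b + unit_shape p - unit_shape q ->
    (forall A i,
       s A i = mxshape A + unit_shape (i, p) - unit_shape (i, q)) ->
  (tens_rows C d a b' \o tmap \1%VF (pmod_move C d p q b b'))%VF =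
  ((\sum_(A : margin_mx d a b) \sum_(i < m)
      (mxincl C d a b' (s A i) \o pmod_move C d (i, p) (i, q) (mxshape A) _
       \o mxproj C A))%VF \o tens_rows C d a b)%VF.
Proof.
move=> npq eb' es; apply: tens_tvec_ext => c c' ac bc'.
have [A Acc'] := tabloid_cap ac bc'.
rewrite !comp_lfunE tmapE id_lfunE pmod_move_of // tens_sumr linear_sum.
rewrite tens_rows_of // (mxsum_vecE _ Acc') sum_lfunE (bigD1 A) //=.
rewrite [X in _ = _ + X]big1 ?addr0 => [|B nBA]; last first.
  rewrite sum_lfunE big1 // => i _.
  by rewrite !comp_lfunE dinj_neq ?linear0 // eq_sym.
(* The point [k] moves within row [c k]. *)
rewrite sum_lfunE (partition_big c xpredT) //=; apply: eq_bigr => i _.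
rewrite !comp_lfunE dinjK pmod_move_of // linear_sum /=.
apply: eq_big => [k|k]; first by rewrite xpair_eqE andbC.
case/andP=> /eqP ck' /eqP ck.
rewrite tens_rows_of //; last by rewrite eb'; apply: is_tab_move.
rewrite (tab_lin_val (mxsum_vec C a b')).
  by congr mxsum_vec; apply: eq_tab_of => x; case: eqP => // ->; rewrite ck.
rewrite es; apply: is_tab_move Acc'; last by rewrite ck ck'.
by rewrite xpair_eqE eqxx.
Qed.

Lemma tens_cols_move m n (a : tshape 'I_m) (b b' : tshape 'I_n) (p q : 'I_n)
    (s : margin_mx d a b -> 'I_m -> tshape ('I_m * 'I_n)) :
    p != q -> b' = b + unit_shape p - unit_shape q ->
    (forall A i,
       s A i = mxshape A + unit_shape (i, p) - unit_shape (i, q)) ->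
  (tens_cols C d a b' \o tmap (pmod_move C d p q b b') \1%VF)%VF =
  ((\sum_(A : margin_mx d a b) \sum_(i < m)
      (mxincl C d a b' (s A i) \o pmod_move C d (i, p) (i, q) (mxshape A) _
       \o mxproj C A))%VF \o tens_cols C d a b)%VF.
Proof.
move=> npq eb' es; rewrite !tens_cols_swap comp_lfunA.
rewrite -(tens_rows_move npq eb' es).
by rewrite -!comp_lfunA swap_tmap.
Qed.
End PermutationModules.

(** * Partitions and closure under tensor products *)

(** A permutation of lists of values lifts to a matching of the indices; it is
    used both to match the cells of a shape with the parts of a partition, and
    the summands of a direct sum with the members of a multiset. *)
Lemma perm_tuple_index (I T : eqType) (f : I -> T) (r : seq I) n
    (t : n.-tuple T) : uniq r -> perm_eq t [seq f i | i <- r] ->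
  exists h : 'I_n -> I, [/\ injective h, forall k, tnth t k = f (h k)
    & forall i, i \in r -> exists k, h k = i].
Proof.
case: r => [|i0 r'] ur pt.
  have n0 : n = 0%N by have := perm_size pt; rewrite size_tuple.
  have noI : 'I_n -> False by rewrite n0 => -[].
  by exists (fun k => False_rect I (noI k)); split=> // k; case: (noI k).
set r := i0 :: r' in ur pt *; pose x0 := f i0.
have [s ps et] := perm_iotaP x0 pt.
rewrite size_map in ps.
have sz : size s = n by rewrite -(size_tuple t) et size_map.
have us : uniq s by rewrite (perm_uniq ps) iota_uniq.
have sr k : k \in s = (k < size r)%N by rewrite (perm_mem ps) mem_iota add0n.
exists (fun k : 'I_n => nth i0 r (nth 0%N s k)).
have inr (k : 'I_n) : (nth 0%N s k < size r)%N by rewrite -sr mem_nth ?sz.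
split=> [k l /eqP|k|i ir].
- by rewrite nth_uniq // nth_uniq ?sz // => /eqP/val_inj.
- by rewrite (tnth_nth x0) et (nth_map 0%N) ?sz // (nth_map i0).
have : index i r \in s by rewrite sr index_mem.
move=> si; have ks : (index (index i r) s < n)%N by rewrite -sz index_mem.
by exists (Ordinal ks); rewrite /= nth_index // nth_index.
Qed.

Section Closure.
Variables (C : fieldType) (d : nat).

Lemma sorts_to_exists (I : finType) (a : tshape I) :
  (forall p, 0 <= a p) -> \sum_p a p = d%:Z ->
  exists nu : intpart d, sorts_to a nu.
Proof.
move=> a_ge0 suma.
pose s := [seq `|a p|%N | p <- enum I & a p != 0].
have nu_part : is_intpart d (sort geq s).
  apply/and3P; split.
  - by apply: sort_sorted => x y; apply: leq_total.
  - rewrite mem_sort; apply/mapP=> -[p]; rewrite mem_filter => /andP[ap _].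
    by move/esym/eqP; rewrite absz_eq0 (negPf ap).
  rewrite (perm_sumn (permEl (perm_sort _ _))) sumnE big_map big_filter.
  rewrite -eqz_nat.
  rewrite (big_morph Posz PoszD (erefl 0%:Z)) -suma big_enum_cond /=.
  rewrite big_mkcond; apply/eqP/eq_bigr => p _.
  by rewrite gez0_abs //; case: eqP.
exists (IntPart nu_part); rewrite /sorts_to /=.
apply: (perm_trans (perm_map _ (permEl (perm_sort _ _)))).
by rewrite /s -map_comp (eq_map (g := a)) // => p; rewrite /= gez0_abs.
Qed.

Lemma pmod_iso_sorted (I : finType) (a : tshape I) (nu : intpart d) :
  sorts_to a nu -> rep_iso (pmod C d a) (pmod C d (pshape nu)).
Proof.
move=> pa.
have [|h [hI hE hS]] := @perm_tuple_index _ _ a _ _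
  (map_tuple Posz (in_tuple nu)) _ pa.
  by rewrite filter_uniq ?enum_uniq.
apply: (pmod_iso_cells C d hI) => [j|p ap].
  by rewrite ffunE -hE tnth_map.
by apply: hS; rewrite mem_filter ap mem_enum.
Qed.

Lemma pshape_sum (l : intpart d) : \sum_i pshape l i = d%:Z.
Proof.
case: l => s sP; case/and3P: (sP) => _ _ /eqP sumd.
rewrite -[in RHS]sumd sumnE (big_morph Posz PoszD (erefl 0%:Z)) big_tnth.
by apply: eq_bigr => i _; rewrite ffunE.
Qed.

Lemma mxshape_sorts m n (a : tshape 'I_m) (b : tshape 'I_n)
    (A : margin_mx d a b) :
  \sum_i a i = d%:Z -> exists nu : intpart d, sorts_to (mxshape A) nu.
Proof.
move=> suma; apply: sorts_to_exists => [p|]; first by rewrite ffunE.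
have /andP[/forallP rows _] := valP A.
rewrite -suma; transitivity (\sum_i \sum_j mxshape A (i, j)).
  by rewrite pair_bigA; apply: eq_bigr => -[].
apply: eq_bigr => i _; rewrite -(eqP (rows i)).
rewrite (big_morph Posz PoszD (erefl 0%:Z)).
by apply: eq_bigr => j _; rewrite ffunE.
Qed.

(** The essential image of [prm_rep], see [in_prmP]; with an arbitrary finite
    index type in place of a multiset, it is closed under direct sums by taking
    the sum of the index types. *)
Definition in_prm (X : rep C d) : Prop :=
  exists (I : finType) (nu : I -> intpart d),
    rep_iso X (dsum_rep (fun i => pmod C d (pshape (nu i)))).

Lemma in_prm_iso X Y : rep_iso X Y -> in_prm Y -> in_prm X.
Proof.
by move=> XY [I [nu Ynu]]; exists I, nu; apply: rep_iso_trans Ynu.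
Qed.

Lemma in_prm_pmod (l : intpart d) : in_prm (pmod C d (pshape l)).
Proof.
exists 'I_1, (fun=> l); pose P (i : 'I_1) := pmod C d (pshape l).
apply: (rep_iso_dsum (X := P) (Y := pmod C d (pshape l))
  (inj := fun=> \1%VF) (prj := fun=> \1%VF)).
- by move=> i g; rewrite comp_lfun1l comp_lfun1r.
- by move=> i x; rewrite !id_lfunE.
- by move=> i j x /negP[]; rewrite (ord1 i) (ord1 j).
- by move=> y; rewrite big_ord1 !id_lfunE.
Qed.

Lemma in_prm_dsum (I : finType) (X : I -> rep C d) :
  (forall i, in_prm (X i)) -> in_prm (dsum_rep X).
Proof.
move=> /fin_all_exists[J /fin_all_exists[nu Xnu]].
exists {i : I & J i}, (fun p => nu (tag p) (tagged p)).
apply: rep_iso_trans (dsum_dsum (fun i j => pmod C d (pshape (nu i j)))).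
by apply: (dsum_reindex (h := id)) => //; exists id.
Qed.

Lemma in_prm_tensor (X Y : prm d) :
  in_prm (tensor_rep (prm_rep C X) (prm_rep C Y)).
Proof.
apply: in_prm_iso (tensor_dsum _ _) _; apply: in_prm_dsum => -[i j] /=.
set l := tnth _ i; set u := tnth _ j.
have iso_lu := tens_rows_isom C d (pshape l) (pshape u).
have := in_prm_iso (ex_intro _ _ iso_lu); apply.
apply: in_prm_dsum => A; have [nu Anu] := mxshape_sorts A (pshape_sum l).
exact: in_prm_iso (pmod_iso_sorted Anu) (in_prm_pmod nu).
Qed.

Lemma in_prmP (X : rep C d) :
  in_prm X -> exists Z : prm d, rep_iso X (prm_rep C Z).
Proof.
case=> I [nu Xnu]; pose Z : prm d := seq_mset [seq nu i | i <- enum I].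
have permZ : perm_eq (in_tuple (enum_mset Z)) [seq nu i | i <- enum I].
  exact: perm_eq_seq_mset.
have [h [hI hE hS]] := perm_tuple_index (enum_uniq I) permZ.
exists Z; apply: rep_iso_trans Xnu _; apply: (dsum_reindex (h := h)).
  have /fin_all_exists[h' hK] : forall i, exists k, h k = i.
    by move=> i; apply: hS; rewrite mem_enum.
  by exists h' => [k|i]; [apply: hI | ]; rewrite hK.
by move=> k; rewrite hE; apply: rep_iso_refl.
Qed.
End Closure.

Theorem theorem6p0p1 (R : realType) (d : nat) :
  (* Prm(S_d) is closed under tensor products *)
  (forall X Y : prm d, exists Z : prm d,
     rep_iso (tensor_rep (prm_rep R[i] X) (prm_rep R[i] Y)) (prm_rep R[i] Z))
  /\
  forall lam mu : intpart d,
    let m := size lam in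
    let n := size mu in
    let l : tshape 'I_m := pshape lam in
    let u : tshape 'I_n := pshape mu in
    [/\ (* objects *)
        [/\ rep_isom (tens_rows R[i] d l u),
            rep_isom (tens_cols R[i] d u l),
            forall A : margin_mx d l u, exists2 nu : intpart d,
              sorts_to (mxshape A) nu &
              rep_iso (pmod R[i] d (mxshape A)) (pmod R[i] d (pshape nu))
          & forall A : margin_mx d u l, exists2 nu : intpart d,
              sorts_to (mxshape A) nu &
              rep_iso (pmod R[i] d (mxshape A)) (pmod R[i] d (pshape nu))],
        (* E_j 1_lam (x) 1_mu *)
        forall j : 'I_m.-1,
          identified (tens_cols R[i] d u l) (tens_cols R[i] d u (l + alpha j))
            (tmap (opE R[i] d j l) \1%VF)
            (\sum_(A : margin_mx d u l) \sum_(i < n)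
               (mxincl R[i] d u (l + alpha j) _
                \o mopE R[i] d i j (mxshape A) \o mxproj R[i] A)%VF),
        (* F_j 1_lam (x) 1_mu *)
        forall j : 'I_m.-1,
          identified (tens_cols R[i] d u l) (tens_cols R[i] d u (l - alpha j))
            (tmap (opF R[i] d j l) \1%VF)
            (\sum_(A : margin_mx d u l) \sum_(i < n)
               (mxincl R[i] d u (l - alpha j) _
                \o mopF R[i] d i j (mxshape A) \o mxproj R[i] A)%VF),
        (* 1_lam (x) E_j 1_mu *)
        forall j : 'I_n.-1,
          identified (tens_rows R[i] d l u) (tens_rows R[i] d l (u + alpha j))
            (tmap \1%VF (opE R[i] d j u))
            (\sum_(A : margin_mx d l u) \sum_(i < m)
               (mxincl R[i] d l (u + alpha j) _
                \o mopE R[i] d i j (mxshape A) \o mxproj R[i] A)%VF)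
      & (* 1_lam (x) F_j 1_mu *)
        forall j : 'I_n.-1,
          identified (tens_rows R[i] d l u) (tens_rows R[i] d l (u - alpha j))
            (tmap \1%VF (opF R[i] d j u))
            (\sum_(A : margin_mx d l u) \sum_(i < m)
               (mxincl R[i] d l (u - alpha j) _
                \o mopF R[i] d i j (mxshape A) \o mxproj R[i] A)%VF)].
Proof.
split=> [X Y|lam mu m n l u]; first exact/in_prmP/in_prm_tensor.
have alphaN k (j : 'I_k.-1) (a : tshape 'I_k) :
    a - alpha j = a + unit_shape (pos1 j) - unit_shape (pos0 j).
  by rewrite opprB addrA.
split.
- split; try exact: tens_rows_isom; try exact: tens_cols_isom.
    move=> A; have [nu Anu] := mxshape_sorts A (pshape_sum lam).
    by exists nu => //; apply: pmod_iso_sorted.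
  move=> A; have [nu Anu] := mxshape_sorts A (pshape_sum mu).
  by exists nu => //; apply: pmod_iso_sorted.
- move=> j; split; try exact: tens_cols_isom.
  apply: tens_cols_move => //; first exact: pos_neq.
  by rewrite addrA.
- move=> j; split; try exact: tens_cols_isom.
  apply: tens_cols_move => [||A i].
  - by rewrite eq_sym pos_neq.
  - exact: alphaN.
  by rewrite addrAC.
- move=> j; split; try exact: tens_rows_isom.
  apply: tens_rows_move => //; first exact: pos_neq.
  by rewrite addrA.
- move=> j; split; try exact: tens_rows_isom.
  apply: tens_rows_move => [||A i].
  - by rewrite eq_sym pos_neq.
  - exact: alphaN.
  by rewrite addrAC.
Qed.
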